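(* Let $M,K,\Phi,\Omega,C,A,\widehat K,Z,J$ be as in the context, with $A$ stable, and let $$\hat X=\int_0^\infty e^{A^Tt}Ze^{At}\,\mathrm dt .$$ Then: (1) $\hat X$ solves the Lyapunov equation $A^T\hat X+\hat XA=-Z$, and for every solution $\mathbf x(t)$ of $M\ddot{\mathbf x}+v\,\mathbf e_k\mathbf e_k^T\dot{\mathbf x}+K\mathbf x=\mathbf 0$ with corresponding initial phase-space vector $\mathbf y_0=\begin{bmatrix}\Omega\Phi^{-1}\mathbf x(0)\\ \Phi^{-1}\dot{\mathbf x}(0)\end{bmatrix}$ one has $$\int_0^\infty\|\mathbf x(t)\|^2\,\mathrm dt=\mathbf y_0^T\hat X\mathbf y_0 .$$ (2) $\operatorname{trace}(\hat X)=\operatorname{trace}(XZ)$, where $X$ is the solution of $A^TX+XA=-I_{2n}$. (3) For every frequency-cut projection $P=P_0\oplus P_0$, where $P_0\in\mathbb R^{n\times n}$ is a diagonal matrix with diagonal entries in $\{0,1\}$, one has $$\operatorname{trace}(\hat XP)=\operatorname{trace}(Z\tilde Y),$$ where $\tilde Y$ is the solution of $A^T\tilde Y+\tilde YA=-P$.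
   Context: $M,K\in\mathbb R^{n\times n}$ are symmetric positive definite, $v>0$, $k\in\{1,\dots,n\}$, and $\mathbf e_k$ is the $k$-th canonical basis vector of $\mathbb R^n$. $\Phi\in\mathbb R^{n\times n}$ is a nonsingular matrix with $$\Phi^TK\Phi=\Omega^2=\operatorname{diag}(\omega_1^2,\dots,\omega_n^2),\qquad \Phi^TM\Phi=I_n,\qquad 0<\omega_1<\dots<\omega_n,$$ and $\Omega=\operatorname{diag}(\omega_1,\dots,\omega_n)$. Put $C=v\,\Phi^T\mathbf e_k\mathbf e_k^T\Phi$, $$A=\begin{bmatrix}0&\Omega\\-\Omega&-C\end{bmatrix},\qquad \widehat K^{-1}=\Omega^{-1}\Phi^T\Phi\,\Omega^{-1},\qquad Z=\begin{bmatrix}\widehat K^{-1}&0\\0&0\end{bmatrix},\qquad J=\begin{bmatrix}I_n&0\\0&-I_n\end{bmatrix}.$$ With $\mathbf y_1=\Omega\Phi^{-1}\mathbf x$, $\mathbf y_2=\Phi^{-1}\dot{\mathbf x}$, the second-order system is equivalent to $\dot{\mathbf y}=A\mathbf y$. Standing assumption: $A$ is (asymptotically) stable, i.e. all its eigenvalues have negative real part, so that the integrals converge and the Lyapunov equations have unique solutions. $\|\cdot\|$ is the Euclidean norm and $\oplus$ is the block-diagonal direct sum. (The ''total average displacement'' criterion is the minimization of the average of $\int_0^\infty\|\mathbf x(t)\|^2\,\mathrm dt$ over initial data $\mathbf y_0$ in the unit sphere, or over the frequency-cut part of it.) *)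

(* Defs.v *)
From HB Require Import structures.
From mathcomp Require Import all_boot all_order all_algebra.
From mathcomp Require Import all_classical all_reals all_analysis.
From mathcomp Require Import complex.

Set Implicit Arguments.
Unset Strict Implicit.
Unset Printing Implicit Defensive.

Import Order.TTheory GRing.Theory Num.Theory.
Import numFieldNormedType.Exports.

Local Open Scope classical_set_scope.
Local Open Scope ring_scope.

Definition posdefmx (R : realType) (n : nat) (M : 'M[R]_n) : Prop :=
  M^T = M /\ forall x : 'cV[R]_n, x != 0 -> 0 < (x^T *m M *m x) 0 0.

(* The eigenvalues of the real matrix A are taken in the complex field R[i]. *)
Definition asymp_stable (R : realType) (n : nat) (A : 'M[R]_n) : Prop :=
  forall z : R[i], eigenvalue (map_mx (real_complex R) A) z -> complex.Re z < 0.

(* The ambient norm `|x| on 'cV[R]_n is the sup norm, not the Euclidean one. *)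
Definition enorm (R : realType) (n : nat) (x : 'cV[R]_n) : R :=
  Num.sqrt (\sum_(i < n) x i 0 ^+ 2).

Definition expmx (R : realType) (n : nat) (A : 'M[R]_n) : 'M[R]_n :=
  limn (series (fun k : nat => (k`!%:R : R)^-1 *: A ^+ k)).

(* Rintegral is total, with an arbitrary value when the integral diverges, so
   convergence of a matrix integral over [0, +oo[ is a separate predicate. *)
Definition mx_integrable0y (R : realType) (m n : nat) (F : R -> 'M[R]_(m, n))
    : Prop :=
  forall i j, (@lebesgue_measure R).-integrable `[0%R, +oo[
    (fun t => (F t i j)%:E).

Definition mx_integral0y (R : realType) (m n : nat) (F : R -> 'M[R]_(m, n))
    : 'M[R]_(m, n) :=
  \matrix_(i, j) (\int[@lebesgue_measure R]_(t in `[0%R, +oo[) F t i j)%R.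

Definition lyapunov (R : realType) (n : nat) (A Q X : 'M[R]_n) : Prop :=
  A^T *m X + X *m A = - Q.

(* x is a solution on [0, +oo[ of M x'' + D x' + K x = 0, with velocity xd.
   The equation is imposed for t > 0; at t = 0, x and xd are required to be
   right-continuous, so that x 0 and xd 0 are the initial position and the
   initial velocity (the one-sided derivative of x). *)
Definition second_order_solution (R : realType) (n : nat) (M D K : 'M[R]_n)
    (x xd : R -> 'cV[R]_n) : Prop :=
  [/\ x t @[t --> 0^'+] --> x 0,
      xd t @[t --> 0^'+] --> xd 0 &
      forall t : R, 0 < t ->
        [/\ is_derive t 1 x (xd t), derivable xd t 1 &
            M *m 'D_1 xd t + D *m xd t + K *m x t = 0] ].

Definition ek (R : realType) (n : nat) (k : 'I_n) : 'cV[R]_n := delta_mx k 0.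

Definition Omega (R : realType) (n : nat) (w : 'rV[R]_n) : 'M[R]_n := diag_mx w.

Definition damping (R : realType) (n : nat) (v : R) (k : 'I_n)
    (Phi : 'M[R]_n) : 'M[R]_n :=
  v *: (Phi^T *m ek R k *m (ek R k)^T *m Phi).

Definition phaseA (R : realType) (n : nat) (v : R) (k : 'I_n)
    (Phi : 'M[R]_n) (w : 'rV[R]_n) : 'M[R]_(n + n) :=
  block_mx 0 (Omega w) (- Omega w) (- damping v k Phi).

Definition Khat_inv (R : realType) (n : nat) (Phi : 'M[R]_n) (w : 'rV[R]_n)
    : 'M[R]_n :=
  invmx (Omega w) *m Phi^T *m Phi *m invmx (Omega w).

Definition phaseZ (R : realType) (n : nat) (Phi : 'M[R]_n) (w : 'rV[R]_n)
    : 'M[R]_(n + n) :=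
  block_mx (Khat_inv Phi w) 0 0 0.

Definition Xhat_integrand (R : realType) (n : nat) (v : R) (k : 'I_n)
    (Phi : 'M[R]_n) (w : 'rV[R]_n) (t : R) : 'M[R]_(n + n) :=
  expmx (t *: (phaseA v k Phi w)^T) *m phaseZ Phi w
    *m expmx (t *: phaseA v k Phi w).

Definition Xhat (R : realType) (n : nat) (v : R) (k : 'I_n)
    (Phi : 'M[R]_n) (w : 'rV[R]_n) : 'M[R]_(n + n) :=
  mx_integral0y (Xhat_integrand v k Phi w).

Definition phase_vector (R : realType) (n : nat) (Phi : 'M[R]_n)
    (w : 'rV[R]_n) (x0 xd0 : 'cV[R]_n) : 'cV[R]_(n + n) :=
  col_mx (Omega w *m invmx Phi *m x0) (invmx Phi *m xd0).

(* Main.v *)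
Require Import Defs.
From HB Require Import structures.
From mathcomp Require Import all_boot all_order all_algebra.
From mathcomp Require Import all_classical all_reals all_analysis.
From mathcomp Require Import complex measurable_realfun ring.

Set Implicit Arguments.
Unset Strict Implicit.
Unset Printing Implicit Defensive.

(** Since A + A^T is negative semidefinite, |y|^2 is nonincreasing along every
    solution of y' = A y. Stability makes the Lyapunov operator
    X |-> A^T X + X A invertible; if A^T S + S A = - I then
    t |y|^2 + y^T S y is nonincreasing as well, so that |y(t)|^2 = O(1/t), and
    no exponential decay rate of exp(tA) is needed. If A^T X + X A = - Z with
    Z >= 0, then y^T Z y is the derivative of - y^T X y, which tends to 0 at
    infinity, hence the integral of y^T Z y is y(0)^T X y(0). Applied to
    y = exp(tA) u and polarized in u this identifies the Gramian with X;
    applied to the phase vector of x it is the energy identity. The trace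
    identities come from J A J = A^T, which turns the solution Y of
    A^T Y + Y A = - P into the solution J Y J of the dual equation. *)

Import Order.TTheory GRing.Theory Num.Theory.
Import numFieldNormedType.Exports.

Local Open Scope classical_set_scope.
Local Open Scope ring_scope.

(** * Lyapunov equations *)

(** Moving [X] leftwards past a linear factor gives [X (A - a) = - (B + a) X], and the invertible
    [B + a] is then cancelled on the left, one root at a time. *)
Lemma mulmx_prod_sub_eq0 (F : fieldType) (m : nat) (A B X : 'M[F]_m.+1)
    (rs : seq F) :
  X * A = - (B * X) -> (forall a, a \in rs -> B + a%:M \in unitmx) ->
  X * \prod_(a <- rs) (A - a%:M) = 0 -> X = 0.
Proof.
move=> XA; elim: rs => [|a rs IHrs] Ba; first by rewrite big_nil mulr1.
rewrite big_cons mulrA mulrBr XA => X0; apply: IHrs => [b rsb|].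
  by apply: Ba; rewrite in_cons rsb orbT.
have aX : X * a%:M = a%:M * X by rewrite -!mulmxE scalar_mxC.
move: X0; rewrite aX -opprD -mulrDl mulNr -mulrA => /eqP; rewrite oppr_eq0.
move=> /eqP /(congr1 (mulmx (invmx (B + a%:M)))).
by rewrite -mulmxE mulKmx ?mulmx0// Ba ?mem_head.
Qed.

(* With p the characteristic polynomial of A, X A = - A^T X gives
   0 = X p(A) = p(-A^T) X, and p(-A^T) is invertible since no two eigenvalues
   of A are opposite. *)
Lemma lyapunov_inj (R : realType) (m : nat) (A X : 'M[R]_m) :
  asymp_stable A -> lyapunov A 0 X -> X = 0.
Proof.
case: m A X => [|m] A X stA; first by move=> _; apply/matrixP => -[].
rewrite /lyapunov oppr0 => /eqP; rewrite addr_eq0 => /eqP AX.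
pose f := map_mx (real_complex R).
have fAX : f m.+1 m.+1 X * f _ _ A = - ((f _ _ A)^T * f _ _ X).
  by rewrite -!mulmxE /f map_trmx -!map_mxM AX map_mxN opprK.
apply: (@map_mx_inj _ _ (real_complex R)); rewrite map_mx0.
have [rs charE] := closed_field_poly_normal (char_poly (f _ _ A)).
move: charE; rewrite (monicP (char_poly_monic _)) scale1r => charE.
apply: (mulmx_prod_sub_eq0 (rs := rs) fAX) => [a rsa|].
  have stA_a : complex.Re a < 0.
    by apply: stA; rewrite eigenvalue_root_char charE root_prod_XsubC.
  (* A nonzero kernel of the transpose [A + a] would make [- a] an eigenvalue, so both [a] and [- a]
     would have negative real part. *)
  rewrite -unitmx_tr linearD /= trmxK tr_scalar_mx -row_free_unit -kermx_eq0.
  apply: contraT => ker_nz; have := stA (- a).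
  rewrite /eigenvalue /eigenspace raddfN /= opprK => /(_ ker_nz).
  by rewrite raddfN /= oppr_lt0 ltNge (ltW stA_a).
have := Cayley_Hamilton (f _ _ A); rewrite charE rmorph_prod /=.
under eq_bigr do rewrite rmorphB /= horner_mx_X horner_mx_C.
by move=> ->; rewrite mulr0.
Qed.

(** An injective endomorphism of a finite-dimensional space is bijective. The Lyapunov operator is
    represented by the square matrix [lin_mx L] acting on vectorized matrices. *)
Lemma lyapunov_unique (R : realType) (m : nat) (A Q : 'M[R]_m) :
  asymp_stable A -> exists X, unique (lyapunov A Q) X.
Proof.
move=> stA; pose L : 'M[R]_m -> 'M[R]_m := mulmx A^T \+ mulmxr A.
have LE X : L X = A^T *m X + X *m A by [].
have Linj X : L X = 0 -> X = 0.
  by move=> X0; apply: lyapunov_inj stA _; rewrite /lyapunov -LE X0 oppr0.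
have Lunit : lin_mx L \in unitmx.
  rewrite -row_free_unit -kermx_eq0; apply/eqP/row_matrixP => i.
  rewrite row0 -[LHS]vec_mxK; set Y := vec_mx _.
  suff -> : Y = 0 by rewrite linear0.
  apply: Linj; apply: (can_inj mxvecK); rewrite linear0 -mul_vec_lin vec_mxK.
  by apply/sub_kermxP; rewrite row_sub.
exists (vec_mx (mxvec (- Q) *m invmx (lin_mx L))); split => [|X' AX'].
  rewrite /lyapunov -LE; apply: (can_inj mxvecK).
  by rewrite -mul_vec_lin vec_mxK mulmxKV.
rewrite -[RHS]mxvecK; congr vec_mx.
by rewrite -AX' -LE -mul_vec_lin mulmxK.
Qed.

(** Transposing the equation shows that [X^T] solves it too; uniqueness concludes. *)
Lemma lyapunov_sym (R : realType) (m : nat) (A Q X : 'M[R]_m) :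
  asymp_stable A -> Q^T = Q -> lyapunov A Q X -> X^T = X.
Proof.
move=> stA symQ AX; have [Y [_ uniqY]] := lyapunov_unique Q stA.
suff AXT : lyapunov A Q X^T by rewrite -(uniqY _ AXT) (uniqY _ AX).
have := congr1 trmx AX.
by rewrite linearD /= !trmx_mul trmxK linearN /= symQ addrC.
Qed.

(** Under the trace pairing, [X |-> A^T X + X A] is adjoint to [Y |-> A Y + Y A^T]. Conjugation by
    [J] carries [Y] to a solution of the dual equation without changing its pairing with [Q]. *)
Lemma trace_lyapunov_conj (R : realType) (m : nat) (A J P Q X Y : 'M[R]_m) :
  J *m J = 1%:M -> J *m A *m J = A^T -> J *m P *m J = P -> J *m Q *m J = Q ->
  lyapunov A Q X -> lyapunov A P Y -> \tr (X *m P) = \tr (Q *m Y).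
Proof.
move=> JJ JAJ JPJ JQJ AX AY.
have JK (B D : 'M[R]_m) : J *m (B *m D) *m J = (J *m B *m J) *m (J *m D *m J).
  by rewrite !mulmxA -(mulmxA (J *m B) J J) JJ mulmx1.
have JATJ : J *m A^T *m J = A.
  by rewrite -JAJ !mulmxA JJ mul1mx -mulmxA JJ mulmx1.
pose Y' := J *m Y *m J.
have AY' : A *m Y' + Y' *m A^T = - P.
  have -> : A *m Y' = J *m (A^T *m Y) *m J by rewrite JK JATJ.
  have -> : Y' *m A^T = J *m (Y *m A) *m J by rewrite JK JAJ.
  by rewrite -mulmxDl -mulmxDr AY mulmxN mulNmx JPJ.
have -> : \tr (Q *m Y) = \tr (Q *m Y').
  by rewrite -[in RHS]JQJ -JK [RHS]mxtrace_mulC !mulmxA JJ mul1mx.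
rewrite -[P]opprK -[Q]opprK -AY' -AX mulmxN mulNmx !raddfN /=.
rewrite mulmxDr mulmxDl !mxtraceD -(mulmxA A^T) (mxtrace_mulC A^T) !mulmxA addrC; congr (- (_ + _)).
Qed.

(** * The matrix exponential *)

(* exprZn does not apply: 'M[R]_m has no algebra structure for general m. *)
Lemma exprZmx (R : comNzRingType) (m : nat) (t : R) (A : 'M[R]_m) k :
  (t *: A) ^+ k = t ^+ k *: A ^+ k.
Proof.
elim: k => [|k IHk]; first by rewrite scale1r.
by rewrite !exprS IHk -!mulmxE -scalemxAl -scalemxAr scalerA.
Qed.

Lemma cvg_mx_entry (R : numFieldType) (T : Type) (F : set_system T)
    (m p : nat) (f : T -> 'M[R]_(m, p)) (L : 'M[R]_(m, p)) i j :
  Filter F -> f @ F --> L -> f x i j @[x --> F] --> L i j.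
Proof.
move=> FF; apply: (@continuous_cvg _ _ _ _ _ f (fun M => M i j)).
exact: coord_continuous.
Qed.

Lemma cvg_mx_entries (R : numFieldType) (T : Type) (F : set_system T)
    (m p : nat) (f : T -> 'M[R]_(m, p)) (L : 'M[R]_(m, p)) :
  Filter F -> (forall i j, f x i j @[x --> F] --> L i j) -> f @ F --> L.
Proof.
move=> FF fL A [P LP PA].
have : \forall x \near F, forall i, forall j, P i j (f x i j).
  by apply: filter_forall => i; apply: filter_forall => j; exact: fL.
by apply: filterS => x Px; exact: PA.
Qed.

(** Coefficient of [t ^+ k] in an entry of [exp(tA)]: the exponential is studied entry by entry as a
    scalar power series. *)
Definition expmx_coef (R : realType) (m : nat) (A : 'M[R]_m) (i j : 'I_m)
    (k : nat) : R := (A ^+ k) i j / k`!%:R.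

(** The entrywise 1-norm, used to bound both the powers of a matrix and its quadratic form. *)
Definition entry_sum (R : realType) (m : nat) (A : 'M[R]_m) : R :=
  \sum_i \sum_j `|A i j|.

Lemma norm_expr_entry_le (R : realType) (m : nat) (A : 'M[R]_m) k i j :
  `|(A ^+ k) i j| <= entry_sum A ^+ k.
Proof.
elim: k i j => [|k IHk] i j.
  by rewrite !expr0 -[1]/1%:M mxE; case: (_ == _); rewrite ?normr1 ?normr0.
rewrite !exprS -mulmxE mxE (le_trans (ler_norm_sum _ _ _))//.
apply: (@le_trans _ _ (\sum_l `|A i l| * entry_sum A ^+ k)).
  by apply: ler_sum => l _; rewrite normrM ler_wpM2l.
rewrite -mulr_suml ler_wpM2r//.
  by rewrite exprn_ge0// sumr_ge0// => ? _; rewrite sumr_ge0.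
rewrite /entry_sum [leRHS](bigD1 i)//= lerDl sumr_ge0// => ? _.
by rewrite sumr_ge0.
Qed.

(** Comparison with [D] times the exponential series at [B * |x|]. The factor [D] absorbs the extra
    powers of [entry_sum A] that differentiation produces. *)
Lemma cvg_pseries_le_fact (R : realType) (c : R^nat) (D B x : R) :
  (forall k, `|c k| <= D * (B ^+ k / k`!%:R)) -> cvgn (pseries c x).
Proof.
move=> cDB; apply: normed_cvg.
have cxD k : `|c k * x ^+ k| <= (D *: exp_coeff (B * `|x|)) k.
  apply: (@le_trans _ _ (D * (B ^+ k / k`!%:R) * `|x| ^+ k)).
    by rewrite normrM normrX ler_wpM2r// exprn_ge0.
  rewrite -mulrA le_eqVlt; apply/orP; left; apply/eqP.
  by rewrite [RHS]/GRing.scale/= /exp_coeff/= exprMn [in RHS]mulrAC.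
apply: (series_le_cvg _ _ cxD) => [k|k|]; first exact: normr_ge0.
- exact: le_trans (cxD k).
- exact/is_cvg_seriesZ/is_cvg_series_exp_coeff.
Qed.

Section expmx.
Variables (R : realType) (m : nat) (A : 'M[R]_m).
Local Notation coef := (expmx_coef A).
Local Notation E t := (expmx (t *: A)).

(** The equation [E' = A E] at the level of coefficients: [A ^+ k.+1 / k! = A * (A ^+ k / k!)]. *)
Lemma expmx_coef_diffs i j k :
  pseries_diffs (coef i j) k = \sum_l A i l * coef l j k.
Proof.
rewrite /pseries_diffs /expmx_coef exprS -mulmxE mxE factS natrM.
rewrite invfM mulrCA mulVKf ?pnatr_eq0// mulr_suml.
by apply: eq_bigr => l _; rewrite mulrA.
Qed.

Lemma is_cvg_expmx_coef i j t : cvgn (pseries (coef i j) t).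
Proof.
apply: (@cvg_pseries_le_fact _ _ 1 (entry_sum A)) => k.
by rewrite mul1r normrM normfV normr_nat ler_wpM2r// norm_expr_entry_le.
Qed.

Lemma cvg_expmx i j t :
  pseries (coef i j) t @ \oo --> (E t) i j.
Proof.
have EE : E t = \matrix_(i, j) limn (pseries (coef i j) t).
  apply/cvg_lim => //; apply: cvg_mx_entries => a b; rewrite mxE.
  suff -> : (fun n => series (fun k => (k`!%:R)^-1 *: (t *: A) ^+ k) n a b) =
      pseries (coef a b) t by exact: is_cvg_expmx_coef.
  apply/funext => n.
  rewrite /pseries /series /= summxE; apply: eq_bigr => k _.
  rewrite exprZmx.
  by rewrite !mxE /expmx_coef [t ^+ k * _]mulrC mulrCA mulrA.
by rewrite EE mxE; exact: is_cvg_expmx_coef.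
Qed.

Lemma cvg_diffs_expmx i j t :
  pseries (pseries_diffs (coef i j)) t @ \oo --> (A *m E t) i j.
Proof.
rewrite mxE.
have -> : pseries (pseries_diffs (coef i j)) t =
    fun n => \sum_l A i l * pseries (coef l j) t n.
  apply/funext => n; rewrite /pseries /series /=.
  under eq_bigr do rewrite expmx_coef_diffs mulr_suml.
  rewrite exchange_big; apply: eq_bigr => l _.
  by rewrite mulr_sumr; apply: eq_bigr => k _; rewrite mulrA.
apply: cvg_big => [|l _]; first exact: add_continuous.
by apply: cvgMl_tmp; exact: cvg_expmx.
Qed.

Lemma is_derive_expmx (i j : 'I_m) (t : R) :
  is_derive t 1 (fun s : R => (E s) i j) ((A *m E t) i j).
Proof.
have EE : (fun s => (E s) i j) = (fun s => limn (pseries (coef i j) s)).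
  by apply/funext => s; exact/esym/cvg_lim/cvg_expmx.
have diffsE : pseries_diffs (coef i j) = (fun k => (A ^+ k.+1) i j / k`!%:R).
  apply/funext => k; rewrite /pseries_diffs /expmx_coef factS natrM invfM.
  by rewrite mulrCA mulVKf ?pnatr_eq0.
have diffs2E : pseries_diffs (pseries_diffs (coef i j)) =
    (fun k => (A ^+ k.+2) i j / k`!%:R).
  rewrite diffsE; apply/funext => k; rewrite /pseries_diffs factS natrM invfM.
  by rewrite mulrCA mulVKf ?pnatr_eq0.
rewrite EE -(cvg_lim _ (@cvg_diffs_expmx i j t))//.
(* Term-by-term differentiation at [t] asks that the series and its first two formal derivatives
   converge at a point of modulus larger than [|t|]; here [|t| + 1]. *)
apply: (@pseries_snd_diffs _ _ (`|t| + 1)).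
- exact: is_cvg_expmx_coef.
- rewrite diffsE.
  apply: (@cvg_pseries_le_fact _ _ (entry_sum A) (entry_sum A)) => k.
  rewrite normrM normfV normr_nat mulrA -exprS ler_wpM2r//.
  exact: norm_expr_entry_le.
- rewrite diffs2E.
  apply: (@cvg_pseries_le_fact _ _ (entry_sum A ^+ 2) (entry_sum A)) => k.
  rewrite normrM normfV normr_nat mulrA -exprD ler_wpM2r//.
  exact: norm_expr_entry_le.
- by rewrite [ltRHS]ger0_norm ?ltrDl// addr_ge0.
Qed.

Lemma expmx0 : E 0 = 1%:M.
Proof.
apply/matrixP => i j; rewrite -(cvg_lim _ (@cvg_expmx i j 0))//.
(* As soon as [n > 0], the partial sum at [t = 0] consists of the [k = 0] term alone. *)
apply/cvg_lim => //; apply: cvg_near_cst; near=> n.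
 rewrite /pseries /series /= (bigD1_seq 0%N) ?iota_uniq//=; last first.
  by rewrite mem_index_iota; near: n; exact: nbhs_infty_gt.
rewrite big1 ?addr0 => [|k /negPf k0]; last by rewrite expr0n k0 mulr0.
by rewrite /expmx_coef !expr0 mulr1 fact0 divr1.
Unshelve. all: end_near. Qed.

End expmx.

Lemma expmx_tr (R : realType) (m : nat) (A : 'M[R]_m) (t : R) :
  expmx (t *: A^T) = (expmx (t *: A))^T.
Proof.
have trX k : A^T ^+ k = (A ^+ k)^T.
  by elim: k => [|k IHk]; [rewrite trmx1 | rewrite exprS IHk exprSr -!mulmxE trmx_mul].
apply/matrixP => i j; rewrite mxE -(cvg_lim _ (@cvg_expmx _ _ A j i t))//.
rewrite -(cvg_lim _ (@cvg_expmx _ _ A^T i j t))//; congr (limn (pseries _ _)).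
by apply/funext => k; rewrite /expmx_coef trX mxE.
Qed.

(** * Quadratic forms along linear flows *)

Definition qform (R : realType) (m : nat) (S : 'M[R]_m) (u : 'cV[R]_m) : R :=
  (u^T *m S *m u) 0 0.

Lemma bilinearE (R : realType) (m : nat) (S : 'M[R]_m) (u v : 'cV[R]_m) :
  (u^T *m S *m v) 0 0 = \sum_i \sum_j u i 0 * (S i j * v j 0).
Proof.
rewrite -mulmxA mxE; apply: eq_bigr => i _.
by rewrite !mxE mulr_sumr.
Qed.

Lemma qform1_ge0 (R : realType) (m : nat) (u : 'cV[R]_m) : 0 <= qform 1%:M u.
Proof.
by rewrite /qform mulmx1 mxE sumr_ge0// => i _; rewrite mxE -expr2 sqr_ge0.
Qed.

Lemma norm_qform_le (R : realType) (m : nat) (S : 'M[R]_m) (u : 'cV[R]_m) :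
  `|qform S u| <= entry_sum S * qform 1%:M u.
Proof.
have le1 i : `|u i 0| ^+ 2 <= qform 1%:M u.
  rewrite /qform mulmx1 mxE (bigD1 i)//= mxE -normrX ger0_norm ?sqr_ge0//.
  by rewrite lerDl sumr_ge0// => ? _; rewrite mxE -expr2 sqr_ge0.
have leM i j : `|u i 0| * `|u j 0| <= qform 1%:M u.
  (* A product of two coordinates is at most the square of the larger one. *)
  have [ij|/ltW ji] := leP `|u i 0| `|u j 0|.
  - by apply: le_trans (le1 j); rewrite expr2 ler_wpM2r.
  - by apply: le_trans (le1 i); rewrite expr2 ler_wpM2l.
rewrite /qform bilinearE (le_trans (ler_norm_sum _ _ _))// mulr_suml.
apply: ler_sum => i _; rewrite (le_trans (ler_norm_sum _ _ _))// mulr_suml.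
apply: ler_sum => j _; rewrite !normrM mulrCA.
by rewrite ler_wpM2l.
Qed.

(** Right-continuity at 0 and the equation only for [t > 0], as in [second_order_solution], so that
    the same lemmas serve [exp(tA) u] and the phase vector of a solution. *)
Definition linear_flow (R : realType) (m : nat) (A : 'M[R]_m)
    (y : R -> 'cV[R]_m) : Prop :=
  (forall i, y t i 0 @[t --> 0^'+] --> y 0 i 0) /\
  (forall (t : R) (i : 'I_m), 0 < t ->
    is_derive t (1 : R) (fun s : R => y s i 0) ((A *m y t) i 0)).

Section linear_flow.
Variables (R : realType) (m : nat) (A : 'M[R]_m) (y : R -> 'cV[R]_m).
Hypothesis flow : linear_flow A y.

Lemma is_derive_qform (S : 'M[R]_m) (t : R) : 0 < t ->
  is_derive t (1 : R) (fun s : R => qform S (y s))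
    (qform (A^T *m S + S *m A) (y t)).
Proof.
move=> t0; have [_ dy] := flow.
have -> : (fun s => qform S (y s)) =
    \sum_i \sum_j ((fun s => y s i 0) * (S i j \*: (fun s => y s j 0))).
  apply/funext => s; rewrite /qform bilinearE fct_sumE; apply: eq_bigr => i _.
  by rewrite fct_sumE.
rewrite /qform mulmxDr mulmxDl mxE -!mulmxA (mulmxA _ A^T) -trmx_mul (mulmxA _ S).
rewrite (mulmxA _ S) !bilinearE -big_split /=.
apply: is_derive_sum => i.
rewrite -big_split /=; apply: is_derive_sum => j.
apply: is_derive_eq.
  by apply: is_deriveM; [exact: dy|apply: is_deriveZ; exact: dy].
by rewrite addrC; congr (_ + _); rewrite /GRing.scale /= [LHS]mulrC.
Qed.

Lemma cvg_qform (S : 'M[R]_m) : qform S (y t) @[t --> 0^'+] --> qform S (y 0).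
Proof.
have [y0 _] := flow.
rewrite /qform bilinearE; under eq_cvg do rewrite bilinearE.
apply: cvg_big => [|i _]; first exact: add_continuous.
apply: cvg_big => [|j _]; first exact: add_continuous.
by apply: cvgM; [exact: y0|apply: cvgMl_tmp; exact: y0].
Qed.

Lemma continuous_qform (S : 'M[R]_m) :
  {within `[0, +oo[, continuous (fun t => qform S (y t))}.
Proof.
apply/continuous_within_itvcyP; split; last exact: cvg_qform.
move=> t; rewrite in_itv/= andbT => t0.
apply/differentiable_continuous/derivable1_diffP.
by have [] := is_derive_qform S t0.
Qed.

Hypothesis dissA : forall u : 'cV[R]_m, qform (A^T + A) u <= 0.

Lemma qform1_nincr (t : R) : 0 <= t -> qform 1%:M (y t) <= qform 1%:M (y 0).
Proof.
move=> t0; pose h s := qform 1%:M (y s).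
apply: (@ler0_derive1_nincry _ h 0) => // s; rewrite ?in_itv/= ?andbT.
- by move=> s0; have [] := is_derive_qform 1%:M s0.
- move=> s0; have dh := is_derive_qform 1%:M s0.
  by rewrite derive1E derive_val mulmx1 mul1mx.
- exact: continuous_qform.
Qed.

(* t |y|^2 + y^T S y is nonincreasing, its derivative being t d|y|^2/dt <= 0. *)
Lemma qform1_decay (S : 'M[R]_m) (t : R) : lyapunov A 1%:M S -> 0 <= t ->
  t * qform 1%:M (y t) <= 2 * entry_sum S * qform 1%:M (y 0).
Proof.
move=> AS t0; pose g s := qform S (y s) + s * qform 1%:M (y s).
have dg (s : R) : 0 < s -> is_derive s (1 : R) g (s * qform (A^T + A) (y s)).
  move=> s0; have dS := is_derive_qform S s0; have d1 := is_derive_qform 1%:M s0.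
  apply: is_derive_eq.
  (* The term [- |y|^2] coming from [S] cancels the [|y|^2] coming from the derivative of the factor
     [s]. *)
  rewrite AS mulmx1 mul1mx /GRing.scale /= mulr1.
  by rewrite /qform mulmxN mulNmx mxE addrC addrK.
have : g t <= g 0.
  apply: (@ler0_derive1_nincry _ g 0) => // [s|s|]; rewrite ?in_itv/= ?andbT.
  - by move=> /dg[].
  - move=> s0; have dgs := dg _ s0.
    by rewrite derive1E derive_val mulr_ge0_le0 // ltW.
  - apply/continuous_within_itvcyP; split.
      move=> s; rewrite in_itv/= andbT => s0.
      by apply/differentiable_continuous/derivable1_diffP; have [] := dg s s0.
    apply: cvgD; first exact: cvg_qform.
    apply: cvgM; last exact: cvg_qform.
    by apply: cvg_at_right_filter; exact: cvg_id.
(* What remains is [t |y(t)|^2 <= y(0)^T S y(0) - y(t)^T S y(t)]. Each form is at most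
   [entry_sum S * |y(0)|^2] in absolute value, whence the factor 2. *)
rewrite /g mul0r addr0 -lerBrDl => /le_trans; apply.
rewrite (le_trans (ler_norm _))// (le_trans (ler_normB _ _))//.
rewrite -mulrA mulr_natl mulr2n lerD//; first exact: norm_qform_le.
rewrite (le_trans (norm_qform_le _ _))// ler_wpM2l ?qform1_nincr//.
by rewrite sumr_ge0// => ? _; rewrite sumr_ge0.
Qed.

Lemma qform_cvg0 (S X : 'M[R]_m) : lyapunov A 1%:M S ->
  qform X (y t) @[t --> +oo] --> 0.
Proof.
move=> AS; pose C := entry_sum X * (2 * entry_sum S * qform 1%:M (y 0)).
apply/norm_cvg0P; apply: (@squeeze_cvgr _ _ _ _ (cst 0) (fun t => C * t^-1)).
- near=> t; have t0 : 0 < t by near: t; exact: nbhs_pinfty_gt.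
  rewrite normr_ge0/= (le_trans (norm_qform_le _ _))// -mulrA ler_wpM2l//.
    by rewrite sumr_ge0// => ? _; rewrite sumr_ge0.
  by rewrite ler_pdivlMr// mulrC; apply: qform1_decay AS (ltW t0).
- exact: cvg_cst.
- rewrite -[X in _ --> X](mulr0 C); apply: cvgMl_tmp.
  by apply/gtr0_cvgV0; [near=> t; near: t; exact: nbhs_pinfty_gt|exact: cvg_id].
Unshelve. all: end_near. Qed.

Lemma integral_qform (Q X S : 'M[R]_m) : lyapunov A 1%:M S -> lyapunov A Q X ->
  (forall u, 0 <= qform Q u) ->
  (\int[lebesgue_measure]_(t in `[0%R, +oo[) (qform Q (y t))%:E
    = (qform X (y 0))%:E)%E.
Proof.
move=> AS AX Q0; rewrite (@ge0_continuous_FTC2y _ _ (fun t => - qform X (y t)) _ 0).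
- by rewrite sub0e EFinN oppeK.
- by move=> t _; exact: Q0.
- exact: continuous_qform.
- by rewrite -oppr0; apply: cvgN; exact: qform_cvg0 AS.
- by move=> t t0; apply: derivableN; have [] := is_derive_qform X t0.
- by apply: cvgN; exact: cvg_qform.
- move=> t; rewrite in_itv/= andbT => t0; have dX := is_derive_qform X t0.
  by rewrite derive1E derive_val AX /qform mulmxN mulNmx mxE opprK.
Qed.

Lemma integrable_qform (Q X S : 'M[R]_m) : lyapunov A 1%:M S -> lyapunov A Q X ->
  (forall u, 0 <= qform Q u) ->
  (@lebesgue_measure R).-integrable `[0%R, +oo[ (fun t => (qform Q (y t))%:E).
Proof.
move=> AS AX Q0; apply/integrableP; split.
  apply/measurable_EFinP; apply: subspace_continuous_measurable_fun => //.
  exact: continuous_qform.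
(* By nonnegativity, the integral of the absolute value is the one already computed, which is
   finite. *)
under eq_integral do rewrite gee0_abs ?lee_fin//.
by rewrite (integral_qform AS AX Q0) ltry.
Qed.

End linear_flow.

(** Reduces integrals of matrix entries to integrals of nonnegative quadratic forms, to which
    [integral_qform] applies. *)
Lemma qform_polarization (R : realType) (m : nat) (S : 'M[R]_m) i j :
  S^T = S ->
  S i j = 2^-1 * (qform S (delta_mx i 0 + delta_mx j 0)
                  - qform S (delta_mx i 0) - qform S (delta_mx j 0)).
Proof.
move=> symS.
have SE a b : ((delta_mx a 0 : 'cV_m)^T *m S *m (delta_mx b 0 : 'cV_m)) 0 0 = S a b.
  by rewrite trmx_delta -rowE -colE !mxE.
have Sji : S j i = S i j by rewrite -[in LHS]symS mxE.
have addE (U V : 'M[R]_1) : (U + V) 0 0 = U 0 0 + V 0 0 by rewrite mxE.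
rewrite /qform [(_ + _)^T]linearD mulmxDl mulmxDr !mulmxDl !addE !SE Sji.
by field.
Qed.

Lemma qform_gram (R : realType) (m p : nat) (G : 'M[R]_(p, m)) u :
  qform (G^T *m G) u = qform 1%:M (G *m u).
Proof. by rewrite /qform mulmx1 trmx_mul !mulmxA. Qed.

Lemma expmx_flow (R : realType) (m : nat) (A : 'M[R]_m) (u : 'cV[R]_m) :
  linear_flow A (fun t => expmx (t *: A) *m u).
Proof.
have dE (t : R) (i : 'I_m) : is_derive t (1 : R)
    (fun s : R => (expmx (s *: A) *m u) i 0)
    ((A *m (expmx (t *: A) *m u)) i 0).
  have -> : (fun s : R => (expmx (s *: A) *m u) i 0) =
      \sum_l (u l 0 \*: (fun s => expmx (s *: A) i l)).
    apply/funext => s; rewrite fct_sumE mxE; apply: eq_bigr => l _.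
    by rewrite [LHS]mulrC.
  rewrite mulmxA mxE; apply: is_derive_sum => l; rewrite mulrC.
  by apply: is_deriveZ; exact: is_derive_expmx.
split => [i|t i _]; last exact: dE.
apply: cvg_at_right_filter.
by apply: differentiable_continuous; apply/derivable1_diffP; have [] := dE 0 i.
Qed.

(** * The observability Gramian *)

Section gramian.
Variables (R : realType) (m : nat) (A Q X S : 'M[R]_m).
Hypotheses (dissA : forall u : 'cV[R]_m, qform (A^T + A) u <= 0)
  (AS : lyapunov A 1%:M S) (AX : lyapunov A Q X)
  (symQ : Q^T = Q) (symX : X^T = X) (Q_ge0 : forall u, 0 <= qform Q u).
Local Notation F := (fun t : R => expmx (t *: A^T) *m Q *m expmx (t *: A)).

Lemma qform_gramian_integrand t u :
  qform (F t) u = qform Q (expmx (t *: A) *m u).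
Proof. by rewrite /qform expmx_tr trmx_mul !mulmxA. Qed.

Lemma integrable_gramian_qform u :
  (@lebesgue_measure R).-integrable `[0%R, +oo[ (EFin \o (fun t => qform (F t) u)).
Proof.
apply: eq_integrable (integrable_qform (expmx_flow A u) dissA AS AX Q_ge0) => //.
by move=> t _ /=; rewrite qform_gramian_integrand.
Qed.

Lemma Rintegral_gramian_qform u :
  (\int[@lebesgue_measure R]_(t in `[0%R, +oo[) qform (F t) u)%R = qform X u.
Proof.
rewrite /Rintegral; under eq_integral do rewrite qform_gramian_integrand.
rewrite (integral_qform (expmx_flow A u) dissA AS AX Q_ge0)/=.
by rewrite expmx0 mul1mx.
Qed.

Lemma gramian_entryE i j : (fun t => F t i j) = (fun t =>
  2^-1 * (qform (F t) (delta_mx i 0 + delta_mx j 0)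
          - qform (F t) (delta_mx i 0) - qform (F t) (delta_mx j 0))).
Proof.
apply/funext => t; apply: qform_polarization.
by rewrite expmx_tr !trmx_mul trmxK symQ mulmxA.
Qed.

(** Linearity of the real-valued integral requires integrability of every partial combination in the
    polarization formula. *)
Lemma integrable_sub_gramian_qform a b :
  (@lebesgue_measure R).-integrable `[0%R, +oo[
    (EFin \o (fun t => qform (F t) a - qform (F t) b)).
Proof.
apply: eq_integrable (integrableB _ (integrable_gramian_qform a)
  (integrable_gramian_qform b)) => //.
Qed.

Lemma integrable_sub2_gramian_qform a b c :
  (@lebesgue_measure R).-integrable `[0%R, +oo[
    (EFin \o (fun t => qform (F t) a - qform (F t) b - qform (F t) c)).
Proof.
apply: eq_integrable (integrableB _ (integrable_sub_gramian_qform a b)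
  (integrable_gramian_qform c)) => //.
Qed.

Lemma gramian_integrable : mx_integrable0y F.
Proof.
move=> i j; have -> : (fun t => (F t i j)%:E) = EFin \o (fun t => F t i j) by [].
rewrite gramian_entryE.
apply: eq_integrable (integrableZl _ 2^-1
  (integrable_sub2_gramian_qform (delta_mx i 0 + delta_mx j 0)
     (delta_mx i 0) (delta_mx j 0))) => //.
Qed.

(** Integrating the polarization formula term by term gives the polarization formula of the
    symmetric matrix [X]. *)
Lemma gramianE : mx_integral0y F = X.
Proof.
apply/matrixP => i j; rewrite mxE gramian_entryE.
rewrite RintegralZl//; last exact: integrable_sub2_gramian_qform.
rewrite RintegralB//; [|exact: integrable_sub_gramian_qform|exact: integrable_gramian_qform].
rewrite RintegralB//; [|exact: integrable_gramian_qform..].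
by rewrite !Rintegral_gramian_qform -qform_polarization.
Qed.

End gramian.

(** * The damped system in phase space *)

Section phase.
Variables (R : realType) (n : nat) (v : R) (k : 'I_n) (Phi : 'M[R]_n) (w : 'rV[R]_n).
Local Notation A := (phaseA v k Phi w).
Local Notation Z := (phaseZ Phi w).
Local Notation J := (block_mx 1%:M 0 0 (- 1%:M) : 'M[R]_(n + n)).

(** The rank-one Gram form, which shows both symmetry and semidefiniteness. *)
Lemma dampingE : damping v k Phi = v *: (((ek R k)^T *m Phi)^T *m ((ek R k)^T *m Phi)).
Proof. by rewrite /damping trmx_mul trmxK !mulmxA. Qed.

Lemma damping_tr : (damping v k Phi)^T = damping v k Phi.
Proof. by rewrite dampingE linearZ /= trmx_mul trmxK. Qed.

Lemma phaseA_tr : A^T = block_mx 0 (- Omega w) (Omega w) (- damping v k Phi).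
Proof.
by rewrite /phaseA tr_block_mx !linearN /= trmx0 damping_tr /Omega tr_diag_mx.
Qed.

Lemma phaseA_diss : 0 < v -> forall u : 'cV[R]_(n + n), qform (A^T + A) u <= 0.
Proof.
move=> v0 u; rewrite phaseA_tr /phaseA add_block_mx addr0 addNr addrN.
(* The [Omega] blocks are skew and cancel in [A^T + A], leaving [- 2 v G^T G]. *)
pose G : 'M[R]_(1, n + n) := row_mx 0 ((ek R k)^T *m Phi).
have -> : block_mx 0 0 0 (- damping v k Phi - damping v k Phi) =
    - (v *+ 2) *: (G^T *m G).
  rewrite /G tr_row_mx mul_col_row !(mul0mx, mulmx0, trmx0) scale_block_mx !scaler0.
  by rewrite dampingE scaleNr -opprD -scalerDl mulr2n.
rewrite /qform -scalemxAr -scalemxAl mxE mulNr oppr_le0 mulr_ge0 ?mulrn_wge0 ?(ltW v0)//.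
by have := qform1_ge0 (G *m u); rewrite -qform_gram.
Qed.

(** [J] flips the sign of the off-diagonal blocks, which for this [A] is transposition since
    [damping] is symmetric. *)
Lemma phaseA_conj : J *m A *m J = A^T.
Proof.
rewrite phaseA_tr /phaseA !mulmx_block.
by rewrite !(mul0mx, mulmx0, mul1mx, mulmx1, mulNmx, mulmxN, addr0, add0r, oppr0, opprK).
Qed.

Lemma signature_conj_diag (B C : 'M[R]_n) :
  J *m block_mx B 0 0 C *m J = block_mx B 0 0 C.
Proof.
rewrite !mulmx_block.
by rewrite !(mul0mx, mulmx0, mul1mx, mulmx1, mulNmx, mulmxN, addr0, add0r, oppr0, opprK).
Qed.

Lemma signature_sq : J *m J = 1%:M.
Proof.
by have := signature_conj_diag 1%:M 1%:M; rewrite -scalar_mx_block mulmx1.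
Qed.

(** The row block [Phi Omega^-1, 0] recovers the position [x] from the phase vector, so the form of
    [Z] is [|x|^2]. *)
Lemma phaseZ_gram :
  Z = (row_mx (Phi *m invmx (Omega w)) 0)^T *m row_mx (Phi *m invmx (Omega w)) 0.
Proof.
rewrite tr_row_mx mul_col_row !(mul0mx, mulmx0, trmx0) /phaseZ /Khat_inv.
by rewrite trmx_mul trmx_inv /Omega tr_diag_mx !mulmxA.
Qed.

Lemma phaseZ_tr : Z^T = Z.
Proof. by rewrite phaseZ_gram trmx_mul trmxK. Qed.

Lemma phaseZ_ge0 u : 0 <= qform Z u.
Proof. by rewrite phaseZ_gram qform_gram qform1_ge0. Qed.

Hypotheses (hPhi : Phi \in unitmx) (hw0 : forall i, 0 < w 0 i).

Lemma Omega_unit : Omega w \in unitmx.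
Proof.
rewrite unitmxE det_diag unitfE; apply/prodf_neq0 => i _.
by rewrite gt_eqF.
Qed.

Lemma enorm_phase_vector x xd :
  enorm x ^+ 2 = qform Z (phase_vector Phi w x xd).
Proof.
rewrite phaseZ_gram qform_gram /phase_vector mul_row_col mul0mx addr0.
rewrite !mulmxA mulmxKV ?Omega_unit// mulmxV// mul1mx.
rewrite /enorm sqr_sqrtr ?sumr_ge0// => [|i _]; last exact: sqr_ge0.
by rewrite /qform mulmx1 mxE; apply: eq_bigr => i _; rewrite mxE expr2.
Qed.

Variables M K : 'M[R]_n.
Hypotheses (hPhiK : Phi^T *m K *m Phi = diag_mx (\row_i (w 0 i ^+ 2)))
  (hPhiM : Phi^T *m M *m Phi = 1%:M).

Lemma phase_vector_field (x xd xdd : 'cV[R]_n) :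
  M *m xdd + (v *: (ek R k *m (ek R k)^T)) *m xd + K *m x = 0 ->
  phase_vector Phi w xd xdd = A *m phase_vector Phi w x xd.
Proof.
move=> eqx; rewrite /phase_vector /phaseA mul_block_col mul0mx add0r.
congr col_mx; first by rewrite mulmxA.
rewrite !mulNmx -opprD; apply/eqP; rewrite -addr_eq0; apply/eqP.
have Omega2 : Omega w *m Omega w = Phi^T *m K *m Phi.
  by rewrite hPhiK /Omega mulmx_diag.
rewrite -[invmx Phi *m xdd]mul1mx -hPhiM !mulmxA Omega2 !(mulmxK hPhi).
rewrite /damping -scalemxAl (mulmxK hPhi).
(* After substituting [1 = Phi^T M Phi] and [Omega^2 = Phi^T K Phi], the lower block is the equation
   of motion multiplied by [Phi^T]. *)
have := congr1 (mulmx Phi^T) eqx; rewrite !mulmxDr mulmx0 !mulmxA => <-.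
by rewrite -scalemxAr -scalemxAl !mulmxA -addrA [X in _ = _ + X]addrC scalemxAl.
Qed.

Lemma phase_vector_flow x xd :
  second_order_solution M (v *: (ek R k *m (ek R k)^T)) K x xd ->
  linear_flow A (fun t => phase_vector Phi w (x t) (xd t)).
Proof.
move=> [x0 xd0 eqx].
(* The phase vector is a constant matrix applied to the stacked position and velocity, so limits and
   derivatives pass through it entrywise. *)
pose L : 'M[R]_(n + n) := block_mx (Omega w *m invmx Phi) 0 0 (invmx Phi).
have LE a b : phase_vector Phi w a b = L *m col_mx a b.
  by rewrite /L mul_block_col !mul0mx addr0 add0r.
have phaseE i : (fun t => phase_vector Phi w (x t) (xd t) i 0) =
    \sum_l (L i l \*: (fun t => col_mx (x t) (xd t) l 0)).
  by apply/funext => t; rewrite fct_sumE LE mxE.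
have colE l : (fun t => col_mx (x t) (xd t) l 0) =
    match fintype.split l with
    | inl i => fun t => x t i 0
    | inr i => fun t => xd t i 0
    end.
  by apply/funext => t; rewrite mxE; case: fintype.split.
split => [i|t i t0].
- rewrite [X in X @ _]phaseE LE mxE fct_sumE.
  apply: cvg_big => [|l _]; first exact: add_continuous.
  apply: cvgZr; rewrite [X in X @ _]colE mxE.
  case: fintype.split => j.
    exact: cvg_mx_entry x0.
  exact: cvg_mx_entry xd0.
- have [dx dxd eqt] := eqx t t0.
  rewrite -(phase_vector_field eqt) LE mxE phaseE.
  apply: is_derive_sum => l; apply: is_deriveZ.
  rewrite colE mxE; case: fintype.split => j.
    have [dxt <-] := dx.
    by rewrite derive_mx// mxE; apply: derivableP; exact: (derivable_mxP _ _ _).1.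
  by rewrite derive_mx// mxE; apply: derivableP; exact: (derivable_mxP _ _ _).1.
Qed.

End phase.

Theorem mainTheorem3 (R : realType) (n : nat) (M K : 'M[R]_n) (v : R)
    (k : 'I_n) (Phi : 'M[R]_n) (w : 'rV[R]_n)
    (hM : posdefmx M) (hK : posdefmx K) (hv : 0 < v)
    (hPhi : Phi \in unitmx)
    (hPhiK : Phi^T *m K *m Phi = diag_mx (\row_i (w 0 i ^+ 2)))
    (hPhiM : Phi^T *m M *m Phi = 1%:M)
    (hw0 : forall i : 'I_n, 0 < w 0 i)
    (hw : forall i j : 'I_n, (i < j)%N -> w 0 i < w 0 j)
    (hA : asymp_stable (phaseA v k Phi w)) :
  [/\ [/\ mx_integrable0y (Xhat_integrand v k Phi w),
          lyapunov (phaseA v k Phi w) (phaseZ Phi w) (Xhat v k Phi w) &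
          forall x xd : R -> 'cV[R]_n,
            second_order_solution M (v *: (ek R k *m (ek R k)^T)) K x xd ->
            let y0 := phase_vector Phi w (x 0) (xd 0) in
            (\int[@lebesgue_measure R]_(t in `[0%R, +oo[)
                (enorm (x t) ^+ 2)%:E
             = ((y0^T *m Xhat v k Phi w *m y0) 0 0)%:E)%E],
      exists X : 'M[R]_(n + n),
        unique (lyapunov (phaseA v k Phi w) 1%:M) X /\
        \tr (Xhat v k Phi w) = \tr (X *m phaseZ Phi w) &
      forall P0 : 'M[R]_n,
        is_diag_mx P0 ->
        (forall i : 'I_n, P0 i i = 0 \/ P0 i i = 1) ->
        let P : 'M[R]_(n + n) := block_mx P0 0 0 P0 in
        exists Y : 'M[R]_(n + n),
          unique (lyapunov (phaseA v k Phi w) P) Y /\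
          \tr (Xhat v k Phi w *m P) = \tr (phaseZ Phi w *m Y)].
Proof.
(* [S] supplies the decay estimate and is also the witness [X] of the second claim; the local [X]
   below is the solution for [Z], to be identified with [Xhat]. *)
have [S uS] := lyapunov_unique 1%:M hA; have [AS _] := uS.
have [X [AX _]] := lyapunov_unique (phaseZ Phi w) hA.
have symX := lyapunov_sym hA (phaseZ_tr Phi w) AX.
have diss := phaseA_diss k Phi w hv.
have Zge0 := phaseZ_ge0 Phi w.
have XhatE : Xhat v k Phi w = X.
  exact: gramianE diss AS AX (phaseZ_tr Phi w) symX Zge0.
(* One identity gives both trace claims: [P0 = 1] yields the second, a frequency cut the third. *)
have trE P0 Y : lyapunov (phaseA v k Phi w) (block_mx P0 0 0 P0) Y ->
    \tr (X *m block_mx P0 0 0 P0) = \tr (phaseZ Phi w *m Y).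
  move=> AY; apply: trace_lyapunov_conj AX AY.
  - exact: signature_sq.
  - exact: phaseA_conj.
  - exact: signature_conj_diag.
  - exact: signature_conj_diag.
rewrite XhatE; split.
- split=> //.
    exact: gramian_integrable diss AS AX (phaseZ_tr Phi w) Zge0.
  move=> x xd solx y0.
  have flow := phase_vector_flow hPhi hPhiK hPhiM solx.
  have -> : (fun t => (enorm (x t) ^+ 2)%:E) =
      (fun t => (qform (phaseZ Phi w) (phase_vector Phi w (x t) (xd t)))%:E).
    by apply/funext => t; rewrite (enorm_phase_vector hPhi hw0 _ (xd t)).
  exact: (integral_qform flow diss AS AX Zge0).
- exists S; split=> //.
  have := trE 1%:M S; rewrite -scalar_mx_block mulmx1 => ->//.
  by rewrite mxtrace_mulC.
- move=> P0 _ _ P; have [Y uY] := lyapunov_unique P hA.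
  by exists Y; split=> //; apply: trE; case: uY.
Qed.
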